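(* Let $M$ be a manifold equipped with an integrable pluricomplex structure. Then the canonical connection $\nabla$ of the pluricomplex structure (defined in the context), a linear connection on $TM$, is torsion-free.
   Context: For a real vector space $V$ of dimension $2n$, $\mathcal{J}(V)$ is the space of complex structures on $V$, regarded as an open subset of $\mathrm{Gr}_n(V^{\mathbb{C}})$ via $J\mapsto V^{1,0}(J)=\{X-iJX\}$, with tautological bundle $\mathcal{V}^{1,0}$. A pluricomplex structure on $V$ is a holomorphic map $K:\mathbb{P}^1\to\mathcal{J}(V)$ with $K^*\mathcal{V}^{1,0}\simeq\mathcal{O}(-1)\otimes\mathbb{C}^n$ and $V^{\mathbb{C}}/K^*\mathcal{V}^{1,0}\simeq\mathcal{O}(1)\otimes\mathbb{C}^n$. A pluricomplex structure on a manifold $M$ is a smooth family of pluricomplex structures $K(m,\cdot)$ on the tangent spaces $T_mM$; it is integrable if each almost complex structure $J_\zeta=K(\cdot,\zeta)$, $\zeta\in\mathbb{P}^1$, is integrable. The complexified tangent bundle $T^{\mathbb{C}}M$ then carries a hypercomplex structure $\tilde K=\{\tilde J_\zeta\}$ commuting with the tautological complex structure $I$ (multiplication by $i$): $\tilde J_\zeta$ acts as $i$ on $T^{1,0}_\zeta M$ and as $-i$ on $T^{1,0}_{-1/\bar\zeta}M$, where $T^{1,0}_\zeta M$ denotes $(1,0)$-vectors for $J_\zeta$. $M$ is real-analytic; $\tilde K$ extends to an integrable hypercomplex structure, commuting with the complex structure, on a complex thickening $M^{\mathbb{C}}$ of $M$ (with $TM^{\mathbb{C}}|_M\simeq T^{\mathbb{C}}M$).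 Let $\tilde\nabla$ be the restriction to $T^{\mathbb{C}}M\to M$ of the torsion-free connection on $M^{\mathbb{C}}$ for which both the complex structure and the hypercomplex structure are parallel (the Obata connection). The canonical connection of the pluricomplex structure is $\nabla_XY=p\bigl(\tilde\nabla_{i(X)}i(Y)\bigr)$, where $i:TM\to T^{\mathbb{C}}M$ is the inclusion and $p:T^{\mathbb{C}}M\to TM$ is $p(v)=\operatorname{Re}v$. *)

(* Defs.v *)
From HB Require Import structures.
From mathcomp Require Import all_boot all_order all_algebra.
From mathcomp Require Import complex.
From mathcomp Require Import all_classical all_reals all_analysis.

Set Implicit Arguments.
Unset Strict Implicit.
Unset Printing Implicit Defensive.
Import Order.TTheory GRing.Theory Num.Theory numFieldNormedType.Exports.
Local Open Scope classical_set_scope.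
Local Open Scope ring_scope.

(** * Smooth maps between normed spaces *)

Section Smooth.
Context {R : realType} {V W : normedModType R}.

Fixpoint Ck (k : nat) (U : set V) (f : V -> W) : Prop :=
  match k with
  | 0%N => forall x, U x -> {for x, continuous f}
  | k'.+1 => (forall x, U x -> differentiable f x) /\
             (forall v, Ck k' U ('D_v f))
  end.

Definition smooth_on (U : set V) (f : V -> W) : Prop := forall k, Ck k U f.

End Smooth.

(** * Smooth manifolds *)

(* [inv] is only meaningful on the image of [dom]. *)
Record chart (R : realType) (M : topologicalType) (d : nat) := Chart {
  dom : set M ;
  to :> M -> 'rV[R]_d ;
  inv : 'rV[R]_d -> M ;
  chart_open_dom : open dom ;
  chart_open_image : open (to @` dom) ;
  chart_invK : forall p, dom p -> inv (to p) = p ;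
  chart_continuous : forall p, dom p -> {for p, continuous to} ;
  chart_inv_continuous :
    forall x, (to @` dom) x -> {for x, continuous inv} }.

Definition smooth_transition (R : realType) (M : topologicalType) (d : nat)
    (c c' : chart R M d) : Prop :=
  smooth_on (c @` (dom c `&` dom c')) (c' \o inv c).

Record manifold (R : realType) (d : nat) := Manifold {
  carrier :> topologicalType ;
  manifold_hausdorff : hausdorff_space carrier ;
  manifold_second_countable : @second_countable carrier ;
  atlas : set (chart R carrier d) ;
  atlas_cover : forall p, exists2 c, atlas c & dom c p ;
  atlas_compatible :
    forall c c', atlas c -> atlas c' -> smooth_transition c c' ;
  atlas_maximal : forall c,
    (forall c', atlas c' -> smooth_transition c c' /\ smooth_transition c' c) ->
    atlas c }.

Section Calculus.
Context {R : realType} {d : nat} {M : manifold R d}.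
Implicit Types (p : M) (U : set M) (f g : M -> R) (c : chart R M d).

Definition smooth_fun U f : Prop :=
  forall c, atlas c -> smooth_on (c @` (dom c `&` U)) (f \o inv c).

Definition smooth_near p f : Prop :=
  exists2 U, open_nbhs p U & smooth_fun U f.

(* A tangent vector at p is a directional derivative at p, acting on the
   functions that are smooth near p.  The value is set to 0 on the other
   functions, so that Leibniz equality of functionals is equality of tangent
   vectors. *)
Definition functional := (M -> R) -> R.
Definition vfield := M -> functional.

Definition dirder c p (w : 'rV[R]_d) : functional :=
  fun f => if `[< smooth_near p f >] then 'D_w (f \o inv c) (c p) else 0.

Definition tangent p (v : functional) : Prop :=
  exists c w, [/\ atlas c, dom c p & v = dirder c p w].

Definition coords c (v : functional) : 'rV[R]_d :=
  \row_k v (fun q => c q 0 k).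

Definition smooth_vf U (X : vfield) : Prop :=
  (forall p, U p -> tangent p (X p)) /\
  (forall (O : set M) f, open O -> O `<=` U -> smooth_fun O f ->
     smooth_fun O (fun p => X p f)).

Definition smooth_vf_near p (X : vfield) : Prop :=
  exists2 U, open_nbhs p U & smooth_vf U X.

Definition bracket (X Y : vfield) : vfield := fun p f =>
  if `[< smooth_near p f >] then X p (Y^~ f) - Y p (X^~ f) else 0.

(** ** Endomorphism fields *)

Definition endo := M -> functional -> functional.

Definition tangent_endo (J : endo) : Prop :=
  (forall p v, tangent p v -> tangent p (J p v)) /\
  (forall p (a : R) u v, tangent p u -> tangent p v ->
     J p (a *: u + v) = a *: J p u + J p v).

Definition smooth_endo (J : endo) : Prop :=
  tangent_endo J /\
  forall U X, open U -> smooth_vf U X -> smooth_vf U (fun p => J p (X p)).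

Definition almost_complex (J : endo) : Prop :=
  smooth_endo J /\ forall p v, tangent p v -> J p (J p v) = - v.

(* Row i holds the coordinates of the image of the i-th coordinate vector:
   J acts on coordinate row vectors by right multiplication. *)
Definition endo_mx c (J : endo) p : 'M[R]_d :=
  \matrix_i coords c (J p (dirder c p (delta_mx 0 i))).

(** ** Linear connections *)

(* [nabla p v Y] is the derivative of Y in the direction v at p.  It is defined
   on local sections: Y only has to be smooth near p. *)
Definition connection := forall p, functional -> vfield -> functional.

Record linear_connection (nabla : connection) : Prop := LinearConnection {
  connection_tangent : forall p v Y, tangent p v -> smooth_vf_near p Y ->
    tangent p (nabla p v Y) ;
  connection_local : forall p v Y Y', tangent p v ->
    smooth_vf_near p Y -> smooth_vf_near p Y' ->
    (\forall q \near p, Y q = Y' q) -> nabla p v Y = nabla p v Y' ;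
  connection_linear : forall p (a : R) u v Y, tangent p u -> tangent p v ->
    smooth_vf_near p Y ->
    nabla p (a *: u + v) Y = a *: nabla p u Y + nabla p v Y ;
  connection_additive : forall p v Y Y', tangent p v ->
    smooth_vf_near p Y -> smooth_vf_near p Y' ->
    nabla p v (fun q => Y q + Y' q) = nabla p v Y + nabla p v Y' ;
  connection_leibniz : forall p v g Y, tangent p v ->
    smooth_near p g -> smooth_vf_near p Y ->
    nabla p v (fun q => g q *: Y q) = v g *: Y p + g p *: nabla p v Y ;
  connection_smooth : forall U X Y, open U -> smooth_vf U X -> smooth_vf U Y ->
    smooth_vf U (fun p => nabla p (X p) Y) }.

Definition torsion_free (nabla : connection) : Prop :=
  forall p X Y, smooth_vf_near p X -> smooth_vf_near p Y ->
    nabla p (X p) Y - nabla p (Y p) X = bracket X Y p.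

Definition parallel (nabla : connection) (J : endo) : Prop :=
  forall p v Y, tangent p v -> smooth_vf_near p Y ->
    nabla p v (fun q => J q (Y q)) = J p (nabla p v Y).

End Calculus.

Arguments functional {R d} M.
Arguments vfield {R d} M.
Arguments endo {R d} M.
Arguments connection {R d} M.

(* Real coordinates (x, y) are the complex coordinates x + iy of C^n, on which
   multiplication by i is (x, y) |-> (-y, x). *)
Definition holomorphic_chart (R : realType) (n : nat) (M : manifold R (n + n))
    (J : endo M) (c : chart R M (n + n)) : Prop :=
  forall p v, dom c p -> tangent p v ->
    coords c (J p v) = row_mx (- rsubmx (coords c v)) (lsubmx (coords c v)).

Definition integrable_acs (R : realType) (n : nat) (M : manifold R (n + n))
    (J : endo M) : Prop :=
  forall p, exists c, [/\ atlas c, dom c p & holomorphic_chart J c].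

(** * Pluricomplex structures *)

(* A point of P^1 is given by homogeneous coordinates z = (z0, z1) <> 0, the
   affine coordinate being zeta = z1 / z0; a function on P^1 is a function on
   C^2 \ 0 that is invariant under scaling. *)

Section PluricomplexSpace.
Context {R : realType}.
Local Notation C := R[i].

Definition holomorphic {p q : nat} (F : 'rV[C]_2 -> 'M[C]_(p, q)) : Prop :=
  forall z, z != 0 -> differentiable F z.

Definition homogeneous1 {p q : nat} (F : 'rV[C]_2 -> 'M[C]_(p, q)) : Prop :=
  forall (a : C) z, a != 0 -> z != 0 -> F (a *: z) = a *: F z.

(* The row space is {X - iJX} in V^C = C^(2n). *)
Definition V10 {m : nat} (J : 'M[R]_m) : 'M[C]_m :=
  1%:M - 'i%C *: map_mx (real_complex R) J.

(* The fibre of O(-1) at [z] is the line Cz.  An isomorphism from O(-1) (x) C^n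
   to K^*V^{1,0} is therefore a map (z, u) |-> u *m F z, with F holomorphic and
   homogeneous of degree 1, carrying C^n onto V^{1,0}(K z).  The fibre of O(1)
   is the dual of that line, so an isomorphism from V^C / K^*V^{1,0} to
   O(1) (x) C^n is induced by a surjection sending v to the C^n-valued form
   z |-> v *m G z, with kernel V^{1,0}(K z), and again G is holomorphic and
   homogeneous of degree 1. *)
Record pluricomplex {n : nat} (K : 'rV[C]_2 -> 'M[R]_(n + n)) : Prop :=
  Pluricomplex {
  pluricomplex_square : forall z, z != 0 -> K z *m K z = - 1%:M ;
  pluricomplex_proj :
    forall (a : C) z, a != 0 -> z != 0 -> K (a *: z) = K z ;
  (* a map into the Grassmannian is holomorphic iff it is locally spanned by a
     holomorphic frame *)
  pluricomplex_holomorphic : forall z, z != 0 ->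
    exists B : 'rV[C]_2 -> 'M[C]_(n, n + n),
      \forall w \near z, differentiable B w /\ (B w == V10 (K w))%MS ;
  pluricomplex_sub : exists F : 'rV[C]_2 -> 'M[C]_(n, n + n),
    [/\ holomorphic F, homogeneous1 F &
        forall z, z != 0 -> (F z == V10 (K z))%MS] ;
  pluricomplex_quotient : exists G : 'rV[C]_2 -> 'M[C]_(n + n, n),
    [/\ holomorphic G, homogeneous1 G &
        forall z, z != 0 -> row_full (G z) /\ (kermx (G z) == V10 (K z))%MS] }.

(* C^2 = R^4, to express smoothness in z *)
Definition cvec (y : 'rV[R]_(2 + 2)) : 'rV[C]_2 :=
  \row_j (Complex (lsubmx y 0 j) (rsubmx y 0 j)).

(* zeta |-> -1 / conj zeta *)
Definition antipode (z : 'rV[C]_2) : 'rV[C]_2 :=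
  \row_j (if j == 0 then - (z 0 1)^*%C else (z 0 0)^*%C).

End PluricomplexSpace.

Section PluricomplexManifold.
Context {R : realType} {n : nat} {M : manifold R (n + n)}.
Local Notation C := R[i].

Record pluricomplex_on (K : 'rV[C]_2 -> endo M) : Prop := PluricomplexOn {
  pluricomplex_on_endo : forall z, z != 0 -> tangent_endo (K z) ;
  pluricomplex_on_fibre : forall c p, atlas c -> dom c p ->
    pluricomplex (fun z => endo_mx c (K z) p) ;
  pluricomplex_on_smooth : forall c, atlas c ->
    smooth_on
      [set x : 'rV[R]_((n + n) + (2 + 2)) |
         (c @` dom c) (lsubmx x) /\ cvec (rsubmx x) != 0]
      (fun x => endo_mx c (K (cvec (rsubmx x))) (inv c (lsubmx x))) }.

Definition integrable_pluricomplex (K : 'rV[C]_2 -> endo M) : Prop :=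
  pluricomplex_on K /\ forall z, z != 0 -> integrable_acs (K z).

End PluricomplexManifold.

(** * Complex thickenings and hypercomplex structures *)

Section Thickening.
Context {R : realType} {d : nat} {M : manifold R d} {N : manifold R (d + d)}.

(* (N, I) is a complex manifold of complex dimension d, and around each point
   of M it has a complex chart in which M is the real part R^d of C^d.  The
   charts of M obtained in this way have real-analytic transition maps: they
   define the real-analytic structure of M that N complexifies. *)
Record thickening (iota : M -> N) (I : endo N) : Prop := Thickening {
  thickening_complex : almost_complex I ;
  thickening_integrable : integrable_acs I ;
  thickening_inj : injective iota ;
  thickening_chart : forall m, exists (c : chart R M d) (c' : chart R N (d + d)),
    [/\ atlas c, atlas c' & holomorphic_chart I c'] /\
    [/\ dom c m, dom c = iota @^-1` dom c',
        forall m', dom c m' -> c' (iota m') = row_mx (c m') 0 &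
        forall q, dom c' q -> rsubmx (c' q) = 0 -> exists m', iota m' = q] }.

(* the differential of iota at m *)
Definition push (iota : M -> N) (m : M) (v : functional M) : functional N :=
  fun f => if `[< smooth_near (iota m) f >] then v (f \o iota) else 0.

End Thickening.

Section Hypercomplex.
Context {R : realType} {n : nat} {N : manifold R (n + n)}.
Local Notation C := R[i].

Record hypercomplex (J1 J2 J3 : endo N) : Prop := Hypercomplex {
  hypercomplex_acs :
    [/\ almost_complex J1, almost_complex J2 & almost_complex J3] ;
  hypercomplex_integrable :
    [/\ integrable_acs J1, integrable_acs J2 & integrable_acs J3] ;
  hypercomplex_quaternion : forall p v, tangent p v ->
    J1 p (J2 p v) = J3 p v /\ J2 p (J1 p v) = - J3 p v }.

(* The sphere of complex structures a J1 + b J2 + c J3 parametrized by P^1: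
   a = (1 - |zeta|^2) / (1 + |zeta|^2),
   b = 2 Re zeta / (1 + |zeta|^2), c = - 2 Im zeta / (1 + |zeta|^2).
   The sign of c is forced: on C^2 (x) C^n the operator that is i on
   z (x) C^n and -i on z^perp (x) C^n is a T1 + b T2 + c T3, where
   T1 = i sigma_3, T2 = i sigma_1, T3 = - i sigma_2 = T1 T2, with sigma_k the
   Pauli matrices. *)
Definition hypercomplex_family (J1 J2 J3 : endo N) (z : 'rV[C]_2) : endo N :=
  fun p v =>
    let sq (w : C) := complex.Re (w * w^*%C) in
    let s := sq (z 0 0) + sq (z 0 1) in
    let w := (z 0 0)^*%C * z 0 1 in
    ((sq (z 0 0) - sq (z 0 1)) / s) *: J1 p v
      + (2 * complex.Re w / s) *: J2 p v
      - (2 * complex.Im w / s) *: J3 p v.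

Definition commuting (J J' : endo N) : Prop :=
  forall p v, tangent p v -> J p (J' p v) = J' p (J p v).

(* nabla is the Obata connection of a hypercomplex structure commuting with I *)
Definition obata (I J1 J2 J3 : endo N) (nabla : connection N) : Prop :=
  [/\ linear_connection nabla, torsion_free nabla, parallel nabla I &
      [/\ parallel nabla J1, parallel nabla J2 & parallel nabla J3]].

End Hypercomplex.

(* Under T^C M = TN|_M, X + iY being sent to push X + I (push Y), the vector
   X - i K_z X of T^{1,0}_z M is sent to [v z]. *)
Definition extends_pluricomplex (R : realType) (n : nat)
    (M : manifold R (n + n)) (N : manifold R ((n + n) + (n + n)))
    (iota : M -> N) (I : endo N) (K : 'rV[R[i]]_2 -> endo M)
    (H : 'rV[R[i]]_2 -> endo N) : Prop :=
  forall m X z, z != 0 -> tangent m X ->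
    let v z' := push iota m X - I (iota m) (push iota m (K z' m X)) in
    H z (iota m) (v z) = I (iota m) (v z) /\
    H z (iota m) (v (antipode z)) = - I (iota m) (v (antipode z)).

(** * The canonical connection *)

Section Canonical.
Context {R : realType} {d : nat} {M : manifold R d} {N : manifold R (d + d)}.
Context (iota : M -> N) (I : endo N) (nablaN : connection N).

(* a vector field on N restricting, near m, to the section s of TN|_M *)
Definition extension (m : M) (s : M -> functional N) : vfield N :=
  xget 0 [set S | smooth_vf_near (iota m) S /\
                  \forall m' \near m, S (iota m') = s m'].

(* the restriction of nablaN to TN|_M *)
Definition restricted_connection (m : M) (v : functional M)
    (s : M -> functional N) : functional N :=
  nablaN (iota m) (push iota m v) (extension m s).

(* Re : T^C M -> TM *)
Definition real_part (m : M) (w : functional N) : functional M :=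
  xget 0 [set u | tangent m u /\ exists2 u', tangent m u' &
                  w = push iota m u + I (iota m) (push iota m u')].

Definition canonical_connection : connection M := fun m v Y =>
  real_part m (restricted_connection m v (fun m' => push iota m' (Y m'))).

End Canonical.

(* Main.v *)
Require Import Defs.
From HB Require Import structures.
From mathcomp Require Import all_boot all_order all_algebra.
From mathcomp Require Import complex.
From mathcomp Require Import all_classical all_reals all_analysis.
(* so that [inv] refers to charts *)
Import Defs.
Set Implicit Arguments.
Unset Strict Implicit.
Unset Printing Implicit Defensive.
Import Order.TTheory GRing.Theory Num.Theory numFieldNormedType.Exports.
Local Open Scope classical_set_scope.
Local Open Scope ring_scope.

(** Let N be the thickening of M, with its torsion-free connection D, and write
    nabla_X Y = Re (D_X Y) for the canonical connection.

    First, D restricts to M: if v is tangent to M, then D_v S depends only on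
    the values of S along M ([connection_along]).  Indeed, by Leibniz' rule in a
    coordinate frame ([connection_frame]), S enters D_v S through its value at
    the point and the derivatives of its components along v.  So any extension
    S of Y may be used to compute nabla_v Y.

    Next, each point of M has charts of M and N in which M is the real part of
    C^d and I is multiplication by i.  There Re keeps the first d coordinates
    of a vector ([real_part_chart_re]), whence the local formula
    [canonical_connectionE] for nabla.  Functions and fields on M extend to N
    by making them, or their coordinates, constant in the imaginary directions
    ([lift], [extends_push]), and the axioms of a linear connection pass from D
    to nabla through this formula, because Re is linear and fixes the vectors
    tangent to M.

    Finally, if S and T extend X and Y, then [S, T] extends [X, Y], so it is
    real along M, and
      nabla_X Y - nabla_Y X = Re (D_S T - D_T S) = Re [S, T] = [X, Y].

    All of this rests on the local calculus of smooth functions and fields.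
    Its main point is that smoothness defined by iterated directional
    derivatives is stable under composition ([Ck_comp]); hence it may be
    checked in a single chart around each point, and a tangent vector is
    determined by its coordinates in any chart. *)

(** * Calculus of C^k maps *)

Section NearEq.
Context {R : realType} {V W : normedModType R}.

(** Both functions have the same first-order expansion, hence the same
    differential. *)
Lemma near_eq_differentiable (f g : V -> W) x :
  (\near x, f x = g x) -> differentiable f x -> differentiable g x.
Proof.
move=> fg df; have [cf ef] := (diff_locallyP _ _).1 df.
have eg : g \o shift x = cst (g x) + 'd f x +o_ 0 id.
  apply/eqaddoP => e e0; move/eqaddoP : ef => /(_ e e0) ef.
  have fg0 : \forall h \near 0, f (h + x) = g (h + x).
    by move: fg; rewrite (near_shift 0) /=; apply: filterS => h; rewrite subr0.
  apply: filterS2 ef fg0 => h + fgh; rewrite -(nbhs_singleton fg).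
  by rewrite -[leLHS]/(`|f (h + x) - _|) fgh.
have gE : 'd g x = 'd f x :> (V -> W) by exact: diff_unique.
by apply/diff_locallyP; rewrite gE.
Qed.

Lemma open_near_eq (U : set V) (f g : V -> W) x : open U -> U x ->
  {in U, f =1 g} -> \near x, f x = g x.
Proof.
move=> oU Ux fg; apply: filterS (open_nbhs_nbhs (conj oU Ux)) => y Uy.
by apply: fg; rewrite inE.
Qed.

End NearEq.

Section CkTheory.
Context {R : realType}.
Implicit Types V W : normedModType R.

Lemma derive_linear V W (L : {linear V -> W}) x v :
  continuous L -> 'D_v L x = L v.
Proof.
by move=> cL; rewrite deriveE ?diff_lin //; exact: linear_differentiable.
Qed.

Lemma Ck_sub V W k (U U' : set V) (f : V -> W) :
  U `<=` U' -> Ck k U' f -> Ck k U f.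
Proof.
elim: k f => [|k IH] f UU' /=; first by move=> + x /UU' Ux; apply.
by move=> [df Df]; split=> [x /UU' /df //|v]; apply: IH.
Qed.

Lemma Ck_ext V W k (U : set V) (f g : V -> W) : open U ->
  {in U, f =1 g} -> Ck k U f -> Ck k U g.
Proof.
move=> oU; elim: k f g => [|k IH] f g fg /=.
  move=> cf x Ux; have fgx := open_near_eq oU Ux fg.
  rewrite -[{for x, _}]/(g @ x --> g x) -(nbhs_singleton fgx : f x = g x).
  by apply: cvg_trans (cf x Ux); apply: near_eq_cvg; apply: filterS fgx.
move=> [df Df]; split=> [x Ux|v].
  exact: near_eq_differentiable (open_near_eq oU Ux fg) (df x Ux).
apply: IH (Df v) => x; rewrite inE => Ux.
exact/near_eq_derive/(open_near_eq oU Ux fg).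
Qed.

Lemma Ck_local V W k (U : set V) (f : V -> W) :
  (forall x, U x -> exists2 U', U' x & Ck k U' f) -> Ck k U f.
Proof.
elim: k f => [|k IH] f /= loc; first by move=> x /loc [U' U'x]; apply.
split=> [x /loc [U' U'x [df _]]|v]; first exact: df.
by apply: IH => x /loc [U' U'x [_ Df]]; exists U'.
Qed.

Lemma CkW V W k (U : set V) (f : V -> W) : Ck k.+1 U f -> Ck k U f.
Proof.
elim: k f => [|k IH] f [df Df] /=.
  by move=> x Ux; exact/differentiable_continuous/df.
by split=> // v; apply: IH; apply: Df.
Qed.

Lemma Ck_cst V W k (U : set V) (a : W) : Ck k U (cst a).
Proof.
elim: k a => [|k IH] a /=; first by move=> x _; exact: cst_continuous.
split=> // v; rewrite (_ : 'D_v _ = cst 0); first exact: IH.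
by apply/funext => x; rewrite derive_cst.
Qed.

Lemma Ck_add V W k (U : set V) (f g : V -> W) : open U ->
  Ck k U f -> Ck k U g -> Ck k U (fun x => f x + g x).
Proof.
move=> oU; elim: k f g => [|k IH] f g /=.
  by move=> cf cg x Ux; apply: continuousD; [exact: cf|exact: cg].
move=> [df Df] [dg Dg]; split=> [x Ux|v].
  by apply: differentiableD; [exact: df|exact: dg].
apply: Ck_ext (IH _ _ (Df v) (Dg v)) => // x; rewrite inE => Ux /=.
by rewrite deriveD //; apply: diff_derivable; [exact: df|exact: dg].
Qed.

Lemma Ck_mul V k (U : set V) (f g : V -> R) : open U ->
  Ck k U f -> Ck k U g -> Ck k U (fun x => f x * g x).
Proof.
move=> oU; elim: k f g => [|k IH] f g.
  by move=> /= cf cg x Ux; apply: continuousM; [exact: cf|exact: cg].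
move=> Cf Cg; have [df Df] := Cf; have [dg Dg] := Cg; split=> [x Ux|v].
  by apply: differentiableM; [exact: df|exact: dg].
apply: (@Ck_ext _ _ _ _ (fun x => f x * 'D_v g x + g x * 'D_v f x)) => //.
  move=> x; rewrite inE => Ux /=.
  by rewrite deriveM //; apply: diff_derivable; [exact: df|exact: dg].
apply: Ck_add => //; apply: IH => //;
  by first [exact: CkW|exact: Df|exact: Dg].
Qed.

Lemma Ck_sum V W k (U : set V) (I : Type) (r : seq I) (F : I -> V -> W) :
  open U -> (forall i, Ck k U (F i)) -> Ck k U (fun x => \sum_(i <- r) F i x).
Proof.
move=> oU CF; elim: r => [|i r IH].
  rewrite (_ : (fun _ => _) = cst 0); first exact: Ck_cst.
  by apply/funext => x; rewrite big_nil.
rewrite (_ : (fun _ => _) = fun x => F i x + \sum_(j <- r) F j x).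
  exact: Ck_add.
by apply/funext => x; rewrite big_cons.
Qed.

(** By induction on k, as post-composition with L commutes with ['D_v]. *)
Lemma Ck_linear V W W' k (U : set V) (f : V -> W) (L : {linear W -> W'}) :
  open U -> continuous L -> Ck k U f -> Ck k U (L \o f).
Proof.
move=> oU cL; elim: k f => [|k IH] f /=.
  move=> cf x Ux.
  by apply: continuous_comp; [exact: (cf x Ux)|exact: (cL (f x))].
have dL y : differentiable L y by exact: linear_differentiable.
move=> [df Df]; split=> [x Ux|v].
  by apply: differentiable_comp => //; exact: df.
apply: Ck_ext (IH _ (Df v)) => // x; rewrite inE => Ux /=.
rewrite [RHS]deriveE; last by apply: differentiable_comp => //; exact: df.
rewrite diff_comp //=; last exact: df.
by rewrite diff_lin // deriveE //; exact: df.
Qed.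

Lemma Ck_linear_map V W k (U : set V) (L : {linear V -> W}) :
  continuous L -> Ck k U L.
Proof.
move=> cL; case: k => [|k] /=; first by move=> x _; exact: cL.
split=> [x _|v]; first exact: linear_differentiable.
rewrite (_ : 'D_v _ = cst (L v)); first exact: Ck_cst.
by apply/funext => x; rewrite derive_linear.
Qed.

End CkTheory.

Section CkRow.
Context {R : realType}.
Implicit Types V W : normedModType R.

Definition row_coord d (j : 'I_d) (v : 'rV[R]_d) : R := v 0 j.

Lemma row_coord_linear d (j : 'I_d) : linear (row_coord j).
Proof. by move=> a u v; rewrite /row_coord !mxE. Qed.

HB.instance Definition _ d (j : 'I_d) :=
  GRing.isLinear.Build _ _ _ _ (row_coord j) (row_coord_linear j).

Lemma row_coord_continuous d (j : 'I_d) : continuous (row_coord j).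
Proof. exact: coord_continuous. Qed.

Lemma Ck_coord V d k (U : set V) (f : V -> 'rV[R]_d) j : open U ->
  Ck k U f -> Ck k U (fun x => f x 0 j).
Proof.
move=> oU; apply: (@Ck_linear _ _ _ _ _ _ _ (row_coord j)) => //.
exact: row_coord_continuous.
Qed.

Lemma derive_rowE W d (g : 'rV[R]_d -> W) x u : differentiable g x ->
  'D_u g x = \sum_j u 0 j *: 'D_(delta_mx 0 j) g x.
Proof.
move=> dg; rewrite deriveE // [in LHS](row_sum_delta u) linear_sum.
by apply: eq_bigr => j _; rewrite linearZ /= deriveE.
Qed.

Lemma derive_comp V V' W (f : V -> V') (g : V' -> W) x v :
  differentiable f x -> differentiable g (f x) ->
  'D_v (g \o f) x = 'D_('D_v f x) g (f x).
Proof.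
move=> df dg; rewrite !deriveE //; last exact: differentiable_comp.
by rewrite diff_comp.
Qed.

(** The chain rule gives D_v (g o f) as the sum of the (D_v f)_j (D_j g o f):
    the first factor is of class C^k, and so is the second by the induction
    hypothesis, applied to D_j g. *)
Lemma Ck_comp V d k (U : set V) (U' : set 'rV[R]_d) (f : V -> 'rV[R]_d)
    (g : 'rV[R]_d -> R) : open U -> (forall x, U x -> U' (f x)) ->
  Ck k U f -> Ck k U' g -> Ck k U (g \o f).
Proof.
move=> oU fU; elim: k f g fU => [|k IH] f g fU.
  move=> cf cg x Ux.
  by apply: continuous_comp; [exact: (cf x Ux)|exact: (cg _ (fU _ Ux))].
move=> Cf Cg; have [df Df] := Cf; have [dg Dg] := Cg; split=> [x Ux|v].
  by apply: differentiable_comp; [exact: df|apply: dg; exact: fU].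
apply: (@Ck_ext _ _ _ _ _
  (fun x => \sum_j 'D_v f x 0 j * ('D_(delta_mx 0 j) g \o f) x)) => //.
  move=> x; rewrite inE => Ux.
  have dgx : differentiable g (f x) by apply: dg; exact: fU.
  by rewrite (derive_comp _ (df x Ux) dgx) (derive_rowE _ dgx).
apply: Ck_sum => // j; apply: Ck_mul => //.
  by apply: Ck_coord => //; exact: Df.
by apply: IH => //; [exact: CkW|exact: Dg].
Qed.

End CkRow.

(** * Functions and tangent vectors in charts *)

Section Charts.
Context {R : realType} {d : nat} {M : manifold R d}.
Implicit Types (p : M) (U O : set M) (f g : M -> R) (c : chart R M d).

Lemma near_dom c p : dom c p -> nbhs p (dom c).
Proof.
by move=> cp; apply: open_nbhs_nbhs; split=> //; exact: chart_open_dom.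
Qed.

Lemma near_image c p : dom c p -> nbhs (c p) (c @` dom c).
Proof.
move=> cp; apply: open_nbhs_nbhs; split; first exact: chart_open_image.
by exists p.
Qed.

Lemma open_image_chart c O : open O -> open (c @` (dom c `&` O)).
Proof.
move=> oO; rewrite openE => _ [p [cp Op] <-].
have cimg : (c @` dom c) (c p) by exists p.
have ci : inv c @ c p --> inv c (c p) := chart_inv_continuous cimg.
have nO : nbhs (c p) (inv c @^-1` O).
  by apply: ci; rewrite chart_invK //; exact: open_nbhs_nbhs.
apply: filterS2 nO (near_image cp) => x + [q cq qx]; rewrite -qx => Oq.
exists q => //.
by split=> //; move: Oq; rewrite /preimage/= chart_invK.
Qed.

Lemma near_chart c p (P : set M) : dom c p -> nbhs p P ->
  \forall x \near c p, P (inv c x).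
Proof.
move=> cp nP; have cimg : (c @` dom c) (c p) by exists p.
have ci : inv c @ c p --> inv c (c p) := chart_inv_continuous cimg.
by apply: ci; rewrite chart_invK.
Qed.

Lemma smooth_fun_sub U U' f : U `<=` U' -> smooth_fun U' f -> smooth_fun U f.
Proof.
move=> UU' sf c ac k; apply: Ck_sub (sf c ac k).
by move=> _ [p [cp Up] <-]; exists p => //; split=> //; exact: UU'.
Qed.

Lemma smooth_fun_ext U f g : open U -> {in U, f =1 g} ->
  smooth_fun U f -> smooth_fun U g.
Proof.
move=> oU fg sf c ac k; apply: Ck_ext (sf c ac k).
  exact: open_image_chart.
move=> x; rewrite inE => -[p [cp Up] <-] /=.
by rewrite chart_invK // fg // inE.
Qed.

Lemma smooth_fun_glue U f :
  (forall p, U p -> exists2 O, O p & smooth_fun O f) -> smooth_fun U f.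
Proof.
move=> loc c ac k; apply: Ck_local => _ [p [cp Up] <-].
have [ O Op sO] := loc _ Up.
by exists (c @` (dom c `&` O)); [exists p|exact: sO].
Qed.

(** In any other chart, [f] is its expression in [c] composed with a transition
    map. *)
Lemma smooth_fun_chart c U f : atlas c -> open U -> U `<=` dom c ->
  smooth_on (c @` (dom c `&` U)) (f \o inv c) -> smooth_fun U f.
Proof.
move=> ac oU Uc sf c0 ac0 k.
have oU0 := open_image_chart (c := c0) oU.
have Ctr : Ck k (c0 @` (dom c0 `&` U)) (c \o inv c0).
  apply: Ck_sub (atlas_compatible ac0 ac k) => _ [p [c0p Up] <-].
  by exists p => //; split=> //; exact: Uc.
apply: (@Ck_ext _ _ _ _ _ ((f \o inv c) \o (c \o inv c0))) => //.
  move=> x; rewrite inE => -[p [c0p Up] <-] /=.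
  by rewrite chart_invK // chart_invK //; exact: Uc.
apply: Ck_comp Ctr (sf k) => // _ [p [c0p Up] <-] /=.
by rewrite chart_invK //; exists p => //; split=> //; exact: Uc.
Qed.

Lemma smooth_fun_cst U (a : R) : smooth_fun U (cst a).
Proof. by move=> c ac k; exact: Ck_cst. Qed.

Lemma smooth_fun_add U f g : open U ->
  smooth_fun U f -> smooth_fun U g -> smooth_fun U (fun p => f p + g p).
Proof.
move=> oU sf sg c ac k.
by apply: Ck_add; [exact: open_image_chart|exact: sf|exact: sg].
Qed.

Lemma smooth_fun_mul U f g : open U ->
  smooth_fun U f -> smooth_fun U g -> smooth_fun U (fun p => f p * g p).
Proof.
move=> oU sf sg c ac k.
by apply: Ck_mul; [exact: open_image_chart|exact: sf|exact: sg].
Qed.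

Lemma smooth_fun_sum U (I : Type) (r : seq I) (F : I -> M -> R) : open U ->
  (forall i, smooth_fun U (F i)) -> smooth_fun U (fun p => \sum_(i <- r) F i p).
Proof.
move=> oU sF c ac k.
by apply: Ck_sum => [|i]; [exact: open_image_chart|exact: sF].
Qed.

Lemma smooth_fun_coord c j : atlas c -> smooth_fun (dom c) (fun p => c p 0 j).
Proof.
move=> ac c' ac' k; apply: (@Ck_coord _ _ _ _ _ (c \o inv c')).
  exact/open_image_chart/chart_open_dom.
exact: atlas_compatible.
Qed.

Lemma smooth_fun_near U f p : open U -> U p -> smooth_fun U f ->
  smooth_near p f.
Proof. by move=> oU Up sf; exists U. Qed.

Lemma smooth_near_eq p f g : (\near p, f p = g p) ->
  smooth_near p f -> smooth_near p g.
Proof.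
move=> nfg; have : nbhs p (fun q => f q = g q) by exact: nfg.
rewrite nbhsE => -[ O [oO Op] fg] [U [oU Up] sf].
exists (U `&` O); first by split=> //; exact: openI.
apply: (@smooth_fun_ext _ f); first exact: openI.
  by move=> q; rewrite inE => -[_ Oq]; exact: fg.
by apply: smooth_fun_sub sf => q [].
Qed.

Lemma smooth_near_differentiable p f c : atlas c -> dom c p ->
  smooth_near p f -> differentiable (f \o inv c) (c p).
Proof.
move=> ac cp [U [oU Up] sf]; have [df _] := sf c ac 1%N.
by apply: df; exists p.
Qed.

Lemma differentiable_transition c c' p : atlas c -> atlas c' ->
  dom c p -> dom c' p -> differentiable (c' \o inv c) (c p).
Proof.
move=> ac ac' cp c'p; have [dcc' _] := atlas_compatible ac ac' 1%N.
by apply: dcc'; exists p.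
Qed.

(** ** Tangent vectors in a chart *)

Lemma dirder_local c p w f g : dom c p -> (\near p, f p = g p) ->
  dirder c p w f = dirder c p w g.
Proof.
move=> cp fg; rewrite /dirder.
have -> : smooth_near p f = smooth_near p g :> Prop.
  apply/propext; split; apply: smooth_near_eq => //.
  by apply: filterS fg => q ->.
case: ifP => // _; apply: near_eq_derive.
exact: (near_chart (P := fun q => f q = g q)).
Qed.

Lemma dirderE c p w f : smooth_near p f ->
  dirder c p w f = 'D_w (f \o inv c) (c p).
Proof. by move=> sf; rewrite /dirder; case: asboolP. Qed.

Lemma dirder_notsmooth c p w f : ~ smooth_near p f -> dirder c p w f = 0.
Proof. by move=> sf; rewrite /dirder; case: asboolP. Qed.

Lemma dirder_linear c p (a : R) u w : atlas c -> dom c p ->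
  dirder c p (a *: u + w) = a *: dirder c p u + dirder c p w.
Proof.
move=> ac cp; apply/funext => f; rewrite -[RHS]/(a * _ + _).
have [sf|nsf] := pselect (smooth_near p f); last first.
  by rewrite !dirder_notsmooth // mulr0 addr0.
have df := smooth_near_differentiable ac cp sf.
by rewrite !dirderE // !deriveE // linearP.
Qed.

(** The chain rule for the transition map. *)
Lemma dirder_change c c' p w : atlas c -> atlas c' -> dom c p -> dom c' p ->
  dirder c p w = dirder c' p ('D_w (c' \o inv c) (c p)).
Proof.
move=> ac ac' cp c'p; apply/funext => f.
have [sf|nsf] := pselect (smooth_near p f); last first.
  by rewrite !dirder_notsmooth.
rewrite !dirderE //.
rewrite (@near_eq_derive _ _ _ _ ((f \o inv c') \o (c' \o inv c))); last first.
  apply: (near_chart (P := fun q => f q = f (inv c' (c' q)))) => //.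
  apply: filterS (near_dom c'p) => q c'q.
  by rewrite chart_invK.
rewrite derive_comp //=; last 2 first.
- exact: differentiable_transition.
- by rewrite chart_invK //; exact: smooth_near_differentiable.
by rewrite chart_invK.
Qed.

Lemma smooth_near_coord c p j : atlas c -> dom c p ->
  smooth_near p (fun q => c q 0 j).
Proof.
move=> ac cp; apply: (@smooth_fun_near (dom c)) => //.
  exact: chart_open_dom.
exact: smooth_fun_coord.
Qed.

Lemma coords_dirder c p w : atlas c -> dom c p -> coords c (dirder c p w) = w.
Proof.
move=> ac cp; apply/rowP => j.
rewrite mxE dirderE; last exact: smooth_near_coord.
rewrite (@near_eq_derive _ _ _ _ (row_coord j)).
  by rewrite derive_linear //; exact: row_coord_continuous.
apply: filterS (near_image cp).
by move=> _ [q cq <-] /=; rewrite chart_invK.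
Qed.

Lemma dirder_coords c p v : atlas c -> dom c p -> tangent p v ->
  dirder c p (coords c v) = v.
Proof.
move=> ac cp [c' [w [ac' c'p ->]]].
by rewrite (dirder_change w ac' ac) // coords_dirder.
Qed.

Lemma tangent_dirder c p w : atlas c -> dom c p -> tangent p (dirder c p w).
Proof. by move=> ac cp; exists c, w. Qed.

Lemma coords_inj c p u v : atlas c -> dom c p -> tangent p u -> tangent p v ->
  coords c u = coords c v -> u = v.
Proof.
move=> ac cp tu tv uv.
by rewrite -(dirder_coords ac cp tu) uv dirder_coords.
Qed.

Lemma coords_linear c (a : R) (u v : functional M) :
  coords c (a *: u + v) = a *: coords c u + coords c v.
Proof. by apply/rowP => j; rewrite !mxE. Qed.

Lemma tangent_linear p (a : R) (u v : functional M) :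
  tangent p u -> tangent p v -> tangent p (a *: u + v).
Proof.
move=> tu tv; have [c ac cp] := atlas_cover p.
rewrite -(dirder_coords ac cp tu) -(dirder_coords ac cp tv) -dirder_linear //.
exact: tangent_dirder.
Qed.

End Charts.

(** * Vector fields *)

Section VectorFields.
Context {R : realType} {d : nat} {M : manifold R d}.
Implicit Types (p : M) (U O : set M) (f g : M -> R) (c : chart R M d).
Implicit Types X Y : vfield M.

Lemma tangent0 p : tangent p (0 : functional M).
Proof.
have [c ac cp] := atlas_cover p; exists c, 0; split=> //.
apply/funext => f; have [sf|nsf] := pselect (smooth_near p f); last first.
  by rewrite dirder_notsmooth.
by rewrite dirderE // derive0.
Qed.

Lemma tangentD p (u v : functional M) :
  tangent p u -> tangent p v -> tangent p (u + v).
Proof. by move=> tu tv; rewrite -[u]scale1r; exact: tangent_linear. Qed.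

Lemma tangentZ p (a : R) (u : functional M) : tangent p u -> tangent p (a *: u).
Proof.
move=> tu; rewrite -[_ *: _]addr0; apply: tangent_linear => //.
exact: tangent0.
Qed.

Lemma tangent_local p (v : functional M) f g : tangent p v ->
  (\near p, f p = g p) -> v f = v g.
Proof. by move=> [c [w [ac cp ->]]]; exact: dirder_local. Qed.

Lemma smooth_vf_sub U U' X : U `<=` U' -> smooth_vf U' X -> smooth_vf U X.
Proof.
move=> UU' [tX sX]; split=> [p /UU' /tX //|O f oO OU sf].
by apply: sX => // p /OU; exact: UU'.
Qed.

Lemma smooth_vf_glue U X :
  (forall p, U p -> exists2 O, open_nbhs p O & smooth_vf O X) -> smooth_vf U X.
Proof.
move=> loc; split=> [p /loc [ O [_ Op] [tX _]]|O f oO OU sf]; first exact: tX.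
apply: smooth_fun_glue => p Op; have [ O' [oO' O'p] [_ sX]] := loc _ (OU _ Op).
exists (O `&` O') => //; apply: sX; [exact: openI|by move=> ? []|].
by apply: smooth_fun_sub sf => ? [].
Qed.

Lemma smooth_vf_ext U X Y : (forall p, U p -> X p = Y p) ->
  smooth_vf U X -> smooth_vf U Y.
Proof.
move=> XY [tX sX]; split=> [p Up|O f oO OU sf].
  by rewrite -XY //; exact: tX.
apply: smooth_fun_ext (sX _ _ oO OU sf) => // p; rewrite inE => /OU Up.
by rewrite XY.
Qed.

Lemma smooth_vf_coord c U X j : atlas c -> open U -> U `<=` dom c ->
  smooth_vf U X -> smooth_fun U (fun p => coords c (X p) 0 j).
Proof.
move=> ac oU Uc [_ sX].
rewrite (_ : (fun _ => _) = fun p => X p (fun q => c q 0 j)).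
  by apply: sX => //; apply: smooth_fun_sub Uc _; exact: smooth_fun_coord.
by apply/funext => p; rewrite mxE.
Qed.

(** The field maps f to the sum of the w_j (D_j f), and the partial derivatives
    of f are smooth along with f. *)
Lemma smooth_vf_dirder c U (w : M -> 'rV[R]_d) :
  atlas c -> open U -> U `<=` dom c ->
  (forall j, smooth_fun U (fun p => w p 0 j)) ->
  smooth_vf U (fun p => dirder c p (w p)).
Proof.
move=> ac oU Uc sw; split=> [p /Uc cp|O f oO OU sf].
  exact: tangent_dirder.
pose D j p := 'D_(delta_mx 0 j) (f \o inv c) (c p).
apply: (@smooth_fun_ext _ _ _ _ (fun p => \sum_j w p 0 j * D j p)) => //.
  move=> p; rewrite inE => Op.
  have sfp : smooth_near p f by exact: smooth_fun_near sf.
  rewrite dirderE // derive_rowE //.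
  by apply: smooth_near_differentiable => //; exact/Uc/OU.
apply: smooth_fun_sum => // j; apply: smooth_fun_mul => //.
  exact: smooth_fun_sub (sw j).
apply: (smooth_fun_chart ac) => // [p /OU /Uc //|k].
apply: (@Ck_ext _ _ _ _ _ ('D_(delta_mx 0 j) (f \o inv c))).
- exact: open_image_chart.
- by move=> x; rewrite inE => -[p [cp Op] <-] /=; rewrite /D chart_invK.
- by have [_] := sf c ac k.+1; apply.
Qed.

Lemma smooth_vf_add U X Y : open U -> smooth_vf U X -> smooth_vf U Y ->
  smooth_vf U (fun p => X p + Y p).
Proof.
move=> oU [tX sX] [tY sY]; split=> [p Up|O f oO OU sf].
  by apply: tangentD; [exact: tX|exact: tY].
by apply: smooth_fun_add => //; [exact: sX|exact: sY].
Qed.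

Lemma smooth_vf_scale U g X : open U -> smooth_fun U g -> smooth_vf U X ->
  smooth_vf U (fun p => g p *: X p).
Proof.
move=> oU sg [tX sX]; split=> [p Up|O f oO OU sf].
  by apply: tangentZ; exact: tX.
by apply: smooth_fun_mul => //; [exact: smooth_fun_sub sg|exact: sX].
Qed.

Lemma smooth_vf0 U : smooth_vf U (fun=> 0).
Proof.
split=> [p _|O f _ _ _]; first exact: tangent0.
exact: (@smooth_fun_cst _ _ _ _ 0).
Qed.

Lemma smooth_vf_near_add p X Y : smooth_vf_near p X -> smooth_vf_near p Y ->
  smooth_vf_near p (fun q => X q + Y q).
Proof.
move=> [U [oU Up] sX] [V [oV Vp] sY]; exists (U `&` V).
  by split=> //; exact: openI.
by apply: smooth_vf_add; [exact: openI|apply: smooth_vf_sub sX => ? []|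
  apply: smooth_vf_sub sY => ? []].
Qed.

Lemma smooth_vf_near_scale p g X : smooth_near p g -> smooth_vf_near p X ->
  smooth_vf_near p (fun q => g q *: X q).
Proof.
move=> [U [oU Up] sg] [V [oV Vp] sX]; exists (U `&` V).
  by split=> //; exact: openI.
by apply: smooth_vf_scale; [exact: openI|apply: smooth_fun_sub sg => ? []|
  apply: smooth_vf_sub sX => ? []].
Qed.

Lemma smooth_vf_near_tangent p X : smooth_vf_near p X -> tangent p (X p).
Proof. by move=> [U [_ Up] [tX _]]; exact: tX. Qed.

Lemma smooth_vf_near_sum p (J : Type) (r : seq J) (Y : J -> vfield M) :
  (forall j, smooth_vf_near p (Y j)) ->
  smooth_vf_near p (fun q => \sum_(j <- r) Y j q).
Proof.
move=> sY; elim: r => [|j r IH].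
  rewrite (_ : (fun _ => _) = fun=> 0).
    by exists setT; [split=> //; exact: openT|exact: smooth_vf0].
  by apply/funext => q; rewrite big_nil.
rewrite (_ : (fun _ => _) = fun q => Y j q + \sum_(i <- r) Y i q).
  exact: smooth_vf_near_add.
by apply/funext => q; rewrite big_cons.
Qed.

(** ** A connection in a frame *)

Lemma connection_sum (nabla : connection M) p v (J : Type) (r : seq J)
    (Y : J -> vfield M) : linear_connection nabla -> tangent p v ->
  (forall j, smooth_vf_near p (Y j)) ->
  nabla p v (fun q => \sum_(j <- r) Y j q) = \sum_(j <- r) nabla p v (Y j).
Proof.
move=> ln tv sY; have nabla0 : nabla p v (fun=> 0) = 0.
  have s0 : smooth_vf_near p (fun=> 0).
    by exists setT; [split=> //; exact: openT|exact: smooth_vf0].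
  apply: (addrI (nabla p v (fun=> 0))); rewrite addr0 -connection_additive //.
  by apply: (congr1 (nabla p v)); apply/funext => q; rewrite addr0.
elim: r => [|j r IH].
  rewrite big_nil -nabla0; apply: (congr1 (nabla p v)).
  by apply/funext => q; rewrite big_nil.
rewrite big_cons -IH -connection_additive //; last exact: smooth_vf_near_sum.
by apply: (congr1 (nabla p v)); apply/funext => q; rewrite big_cons.
Qed.

Definition frame c k : vfield M := fun q => dirder c q (delta_mx 0 k).

Lemma smooth_frame c k p : atlas c -> dom c p -> smooth_vf_near p (frame c k).
Proof.
move=> ac cp; exists (dom c); first by split=> //; exact: chart_open_dom.
apply: smooth_vf_dirder => //; first exact: chart_open_dom.
by move=> j; exact: smooth_fun_cst.
Qed.

Lemma dirder_sum c p w : atlas c -> dom c p ->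
  dirder c p w = \sum_k w 0 k *: frame c k p.
Proof.
move=> ac cp; rewrite [in LHS](row_sum_delta w).
have d0 : dirder c p 0 = 0.
  apply: (coords_inj ac cp); [exact: tangent_dirder|exact: tangent0|].
  by rewrite coords_dirder //; apply/rowP => j; rewrite !mxE.
elim: (index_enum _) => [|k r IH]; first by rewrite !big_nil.
by rewrite !big_cons dirder_linear // IH.
Qed.

(** Near [p], [X] is the combination of the coordinate fields with its
    components as coefficients; locality, additivity and Leibniz' rule do the
    rest.  Only the values at [p] and the [v]-derivatives of these components
    occur. *)
Lemma connection_frame (nabla : connection M) c p v X :
  linear_connection nabla -> atlas c -> dom c p -> tangent p v ->
  smooth_vf_near p X ->
  nabla p v X = \sum_k (v (fun q => coords c (X q) 0 k) *: frame c k p +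
                        coords c (X p) 0 k *: nabla p v (frame c k)).
Proof.
move=> ln ac cp tv sX; have [U [oU Up] sXU] := sX.
have ocU : open (dom c `&` U) by apply: openI => //; exact: chart_open_dom.
have sx k : smooth_near p (fun q => coords c (X q) 0 k).
  apply: (smooth_fun_near ocU) => //; apply: smooth_vf_coord => //.
  by apply: smooth_vf_sub sXU => ? [].
have sxE k : smooth_vf_near p (fun q => coords c (X q) 0 k *: frame c k q).
  by apply: smooth_vf_near_scale => //; exact: smooth_frame.
rewrite (@connection_local _ _ _ _ ln _ _ _
  (fun q => \sum_k coords c (X q) 0 k *: frame c k q)) //.
- rewrite connection_sum //; apply: eq_bigr => k _.
  by rewrite connection_leibniz //; exact: smooth_frame.
- exact: smooth_vf_near_sum.
- apply: filterS (open_nbhs_nbhs (conj ocU (conj cp Up))) => q [cq Uq].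
  by rewrite -dirder_sum // dirder_coords //; exact: (sXU.1).
Qed.

End VectorFields.

(** * Charts adapted to a thickening *)

Section RealPart.
Context {R : realType} {d : nat}.

Definition real_row (x : 'rV[R]_d) : 'rV[R]_(d + d) := row_mx x 0.

Lemma real_row_linear : linear real_row.
Proof.
by move=> a u v; rewrite /real_row scale_row_mx add_row_mx scaler0 addr0.
Qed.

HB.instance Definition _ :=
  GRing.isLinear.Build _ _ _ _ real_row real_row_linear.

Lemma continuous_real_row : continuous real_row.
Proof.
move=> u A /nbhs_ballP[e /= e0 eA].
apply/nbhs_ballP; exists e => //= v [_ uv]; apply: eA; split=> // i j.
rewrite /real_row !mxE; case: splitP => k _; last by rewrite mxE; exact: ballxx.
exact: uv.
Qed.

Lemma real_row_differentiable x : differentiable real_row x.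
Proof. exact/linear_differentiable/continuous_real_row. Qed.

Lemma derive_real_row x w : 'D_w real_row x = real_row w.
Proof.
exact/derive_linear/continuous_real_row.
Qed.

End RealPart.

(** A pair of charts in which M is the real part of C^d. *)
Record adapted {R : realType} {d : nat} {M : manifold R d}
    {N : manifold R (d + d)} (iota : M -> N) (c : chart R M d)
    (c' : chart R N (d + d)) : Prop := Adapted {
  adapted_atlas : atlas c ;
  adapted_atlas' : atlas c' ;
  adapted_dom : dom c = iota @^-1` dom c' ;
  adapted_iota : forall m, dom c m -> c' (iota m) = real_row (c m) }.

Section Adapted.
Context {R : realType} {d : nat} {M : manifold R d} {N : manifold R (d + d)}.
Context (iota : M -> N) (c : chart R M d) (c' : chart R N (d + d)).
Context (cc' : adapted iota c c').
Implicit Types (m : M) (q : N).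
Let ac : atlas c := adapted_atlas cc'.
Let ac' : atlas c' := adapted_atlas' cc'.

Lemma adapted_dom' m : dom c m -> dom c' (iota m).
Proof. by rewrite (adapted_dom cc'). Qed.

Lemma near_iota m (P : set N) : dom c m -> nbhs (iota m) P ->
  \forall m' \near m, P (iota m').
Proof.
move=> cm nP; have c'm := adapted_dom' cm.
have nrow := near_chart c'm nP.
have cc : c @ m --> c m := chart_continuous cm.
have nc : \forall m' \near m, P (inv c' (real_row (c m'))).
  apply: (cc (fun x => P (inv c' (real_row x)))).
  apply: (@continuous_real_row _ _ (c m) (fun y => P (inv c' y))).
  by rewrite -(adapted_iota cc').
apply: filterS2 nc (near_dom cm) => m' + cm'.
by rewrite -(adapted_iota cc') // chart_invK //; exact: adapted_dom'.
Qed.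

Lemma open_iota (W : set N) : open W -> open (dom c `&` iota @^-1` W).
Proof.
move=> oW; rewrite openE => m [cm Wm].
have nW : \forall m' \near m, W (iota m').
  by apply: near_iota => //; exact: open_nbhs_nbhs.
by apply: filterS2 (near_dom cm) nW => m'; split.
Qed.

Lemma smooth_fun_iota (W : set N) (f : N -> R) : open W -> smooth_fun W f ->
  smooth_fun (dom c `&` iota @^-1` W) (f \o iota).
Proof.
move=> oW sf; have oU := open_iota oW.
apply: (smooth_fun_chart ac) => // k.
have oI : open (c @` (dom c `&` (dom c `&` iota @^-1` W))).
  exact: open_image_chart.
apply: (@Ck_ext _ _ _ _ _ ((f \o inv c') \o real_row)) => //.
  move=> x; rewrite inE => -[m [cm _] <-] /=.
  rewrite -(adapted_iota cc') // !chart_invK //; exact: adapted_dom'.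
apply: Ck_comp (Ck_linear_map _ _ _) (sf c' ac' k) => //; last first.
  exact: continuous_real_row.
move=> _ [m [cm [_ Wm]] <-]; exists (iota m); last exact: (adapted_iota cc').
by split=> //; exact: adapted_dom'.
Qed.

Lemma smooth_near_iota m (f : N -> R) : dom c m -> smooth_near (iota m) f ->
  smooth_near m (f \o iota).
Proof.
move=> cm [W [oW Wm] sf]; apply: (smooth_fun_near (open_iota oW)) => //.
exact: smooth_fun_iota.
Qed.

(** The extension of a function on M, near a point of the chart, that does not
    depend on the imaginary coordinates. *)
Definition lift (g : M -> R) : N -> R := g \o inv c \o lsubmx \o c'.

Lemma lift_iota g m : dom c m -> lift g (iota m) = g m.
Proof.
by move=> cm; rewrite /lift /= (adapted_iota cc') // row_mxKl chart_invK.
Qed.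

Definition lift_dom (U : set M) : set N :=
  dom c' `&` [set q | (c @` (dom c `&` U)) (lsubmx (c' q))].

Lemma lift_dom_open U : open U -> open (lift_dom U).
Proof.
move=> oU; rewrite openE => q [c'q Uq].
have cc : c' @ q --> c' q := chart_continuous c'q.
have nU : \forall r \near q, (c @` (dom c `&` U)) (lsubmx (c' r)).
  apply: (cc (fun y => (c @` (dom c `&` U)) (lsubmx y))).
  apply: (@continuous_lsubmx _ _ _ _ (c' q) (c @` (dom c `&` U))).
  by apply: open_nbhs_nbhs; split=> //; exact: open_image_chart.
by apply: filterS2 (near_dom c'q) nU => r; split.
Qed.

Lemma lift_dom_iota U m : dom c m -> U m -> lift_dom U (iota m).
Proof.
move=> cm Um; split; first exact: adapted_dom'.
by rewrite /= (adapted_iota cc') // row_mxKl; exists m.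
Qed.

Lemma smooth_lift U g : open U -> smooth_fun U g ->
  smooth_fun (lift_dom U) (lift g).
Proof.
move=> oU sg; have oL := lift_dom_open oU.
apply: (smooth_fun_chart ac') => // [? []//|k].
have oI : open (c' @` (dom c' `&` lift_dom U)) by exact: open_image_chart.
apply: (@Ck_ext _ _ _ _ _
  ((g \o inv c) \o (lsubmx : 'rV[R]_(d + d) -> 'rV[R]_d))) => //.
  move=> x; rewrite inE => -[q [c'q _] <-] /=.
  by rewrite /lift /= chart_invK.
apply: Ck_comp (Ck_linear_map _ _ _) (sg c ac k) => //; last first.
  exact: continuous_lsubmx.
by move=> _ [q [_ [_ Uq]] <-].
Qed.

Lemma smooth_near_lift m g : dom c m -> smooth_near m g ->
  smooth_near (iota m) (lift g).
Proof.
move=> cm [U [oU Um] sg]; apply: (smooth_fun_near (lift_dom_open oU)).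
  exact: lift_dom_iota.
exact: smooth_lift.
Qed.

(** ** The differential of the inclusion *)

Lemma push_dirder m w : dom c m ->
  push iota m (dirder c m w) = dirder c' (iota m) (real_row w).
Proof.
move=> cm; have c'm := adapted_dom' cm; apply/funext => f.
rewrite /push /dirder; case: asboolP => // sf.
rewrite ifT; last by apply/asboolP; exact: smooth_near_iota.
rewrite (@near_eq_derive _ _ _ _ ((f \o inv c') \o real_row)); last first.
  apply: filterS (near_image cm).
  move=> _ [q cq <-] /=; rewrite -(adapted_iota cc') // !chart_invK //.
  exact: adapted_dom'.
rewrite derive_comp ?derive_real_row -?(adapted_iota cc') //.
  exact: real_row_differentiable.
exact: smooth_near_differentiable.
Qed.

Lemma push_tangent m v : dom c m -> tangent m v ->
  tangent (iota m) (push iota m v).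
Proof.
move=> cm tv; rewrite -(dirder_coords ac cm tv) push_dirder //.
by apply: tangent_dirder => //; exact: adapted_dom'.
Qed.

Lemma coords_push m v : dom c m -> tangent m v ->
  coords c' (push iota m v) = real_row (coords c v).
Proof.
move=> cm tv; rewrite -{1}(dirder_coords ac cm tv) push_dirder //.
by rewrite coords_dirder //; exact: adapted_dom'.
Qed.

Lemma push_lift m v g : dom c m -> tangent m v -> smooth_near m g ->
  push iota m v (lift g) = v g.
Proof.
move=> cm tv sg; rewrite /push.
case: asboolP => [_|[]]; last exact: smooth_near_lift.
apply: (tangent_local tv); apply: filterS (near_dom cm) => m' cm' /=.
exact: lift_iota.
Qed.

(** ** Sections of TN along M *)

Definition extends (m : M) (s : M -> functional N) (S : vfield N) : Prop :=
  smooth_vf_near (iota m) S /\ \forall m' \near m, S (iota m') = s m'.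

(** Extend the coordinates by [lift], with vanishing imaginary part. *)
Lemma extends_push m Y : dom c m -> smooth_vf_near m Y ->
  exists S, extends m (fun m' => push iota m' (Y m')) S.
Proof.
move=> cm [U [oU Um] sY].
pose y j m' := coords c (Y m') 0 j.
pose S : vfield N := fun q => dirder c' q (real_row (\row_j lift (y j) q)).
have ocU : open (dom c `&` U) by apply: openI => //; exact: chart_open_dom.
have oL := lift_dom_open ocU.
exists S; split.
  exists (lift_dom (dom c `&` U)); first by split=> //; exact: lift_dom_iota.
  apply: smooth_vf_dirder => // [? []//|j].
  case: (split_ordP j) => k ->.
    rewrite (_ : (fun _ => _) = lift (y k)).
      apply: smooth_lift => //; apply: smooth_vf_coord => //.
      by apply: smooth_vf_sub sY => ? [].
    by apply/funext => q; rewrite row_mxEl mxE.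
  rewrite (_ : (fun _ => _) = cst 0); first exact: smooth_fun_cst.
  by apply/funext => q; rewrite row_mxEr mxE.
apply: filterS (open_nbhs_nbhs (conj ocU (conj cm Um))) => m' [cm' Um'].
rewrite /S -[in RHS](dirder_coords ac cm' (sY.1 _ Um')) push_dirder //.
by congr (dirder _ _ (real_row _)); apply/rowP => j; rewrite mxE lift_iota.
Qed.

(** In [connection_frame] the components are differentiated along a vector
    tangent to M, so only their values on M matter.  This makes
    [restricted_connection] independent of the chosen extension. *)
Lemma connection_along (nabla : connection N) m v (s : M -> functional N) S S' :
  linear_connection nabla -> dom c m -> tangent m v ->
  extends m s S -> extends m s S' ->
  nabla (iota m) (push iota m v) S = nabla (iota m) (push iota m v) S'.
Proof.
move=> ln cm tv [sS eS] [sS' eS']; have c'm := adapted_dom' cm.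
have tp := push_tangent cm tv.
rewrite !(connection_frame (c := c') ln) //; apply: eq_bigr => k _.
have -> : S (iota m) = S' (iota m).
  by rewrite (nbhs_singleton eS : S (iota m) = s m) (nbhs_singleton eS').
congr (_ *: _ + _).
have sx X : smooth_vf_near (iota m) X ->
    smooth_near (iota m) (fun q => coords c' (X q) 0 k).
  move=> [U [oU Um] sX].
  have oU' : open (dom c' `&` U) by apply: openI => //; exact: chart_open_dom.
  apply: (smooth_fun_near oU') => //; apply: smooth_vf_coord => //.
  by apply: smooth_vf_sub sX => ? [].
rewrite /push; case: asboolP => [_|[]]; last exact: sx.
case: asboolP => [_|[]]; last exact: sx.
apply: (tangent_local tv).
by apply: filterS2 eS eS' => m' /= -> ->.
Qed.

(** The real part, provided that I is multiplication by i in [c']: see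
    [real_part_chart_re]. *)
Definition chart_re (m : M) (w : functional N) : functional M :=
  dirder c m (lsubmx (coords c' w)).

Lemma chart_re_linear m (a : R) u w : dom c m ->
  chart_re m (a *: u + w) = a *: chart_re m u + chart_re m w.
Proof.
by move=> cm; rewrite /chart_re coords_linear !linearP /= dirder_linear.
Qed.

Lemma chart_re_scale m (a : R) u : dom c m ->
  chart_re m (a *: u) = a *: chart_re m u.
Proof.
move=> cm; have re0 : chart_re m 0 = 0.
  apply: (addrI (chart_re m 0)).
  by rewrite addr0 -{1}[chart_re m 0]scale1r -chart_re_linear // scaler0 addr0.
by rewrite -[_ *: _]addr0 chart_re_linear // re0 addr0.
Qed.

Lemma chart_re_push m v : dom c m -> tangent m v ->
  chart_re m (push iota m v) = v.
Proof.
by move=> cm tv; rewrite /chart_re coords_push // row_mxKl dirder_coords.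
Qed.

Context (I : endo N) (hI : almost_complex I) (hol : holomorphic_chart I c').

(** In coordinates, the vectors tangent to M are those with vanishing last d
    entries, and I maps them to those with vanishing first d entries: the real
    and imaginary parts of [w] are the two halves of its coordinates. *)
Lemma real_part_chart_re m w : dom c m -> tangent (iota m) w ->
  real_part iota I m w = chart_re m w.
Proof.
move=> cm tw; have c'm := adapted_dom' cm.
have [[[tI _] _] _] := hI.
have cI v : tangent m v ->
    coords c' (I (iota m) (push iota m v)) = row_mx 0 (coords c v).
  move=> tv; rewrite hol //; last exact: push_tangent.
  by rewrite coords_push // row_mxKl row_mxKr oppr0.
rewrite /real_part.
case: xgetP => [u _ [tu [u' tu' ->]]|/(_ (chart_re m w)) []].
  rewrite /chart_re -[push iota m u]scale1r coords_linear scale1r.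
  rewrite coords_push // cI //.
  by rewrite add_row_mx addr0 row_mxKl dirder_coords.
split; first exact: tangent_dirder.
exists (dirder c m (rsubmx (coords c' w))); first exact: tangent_dirder.
have tI' v : tangent m v -> tangent (iota m) (I (iota m) (push iota m v)).
  by move=> tv; apply: tI; exact: push_tangent.
apply: (coords_inj ac' c'm tw).
  apply: tangentD; first by apply: push_tangent => //; exact: tangent_dirder.
  by apply: tI'; exact: tangent_dirder.
rewrite -[push iota m _]scale1r coords_linear scale1r.
rewrite coords_push //; last exact: tangent_dirder.
rewrite cI; last exact: tangent_dirder.
by rewrite /chart_re !coords_dirder // add_row_mx addr0 add0r hsubmxK.
Qed.

(** By [connection_along] the extension picked in the definition may be replaced
    by any other. *)
Lemma canonical_connectionE (nablaN : connection N) m v Y S :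
  linear_connection nablaN -> dom c m -> tangent m v ->
  extends m (fun m' => push iota m' (Y m')) S ->
  canonical_connection iota I nablaN m v Y =
  chart_re m (nablaN (iota m) (push iota m v) S).
Proof.
move=> ln cm tv eS; rewrite /canonical_connection /restricted_connection.
have eS' : extends m (fun m' => push iota m' (Y m'))
    (extension iota m (fun m' => push iota m' (Y m'))).
  by rewrite /extension; case: xgetP => // /(_ S) [].
rewrite (connection_along ln cm tv eS' eS) real_part_chart_re //.
by apply: connection_tangent => //; [exact: push_tangent|exact: eS.1].
Qed.

End Adapted.

(** * Brackets *)

Section Bracket.
Context {R : realType} {d : nat} {M : manifold R d} {N : manifold R (d + d)}.
Context (iota : M -> N) (c : chart R M d) (c' : chart R N (d + d)).
Context (cc' : adapted iota c c').
Implicit Types (m : M) (f : M -> R) (X Y : vfield M) (S T : vfield N).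
Let ac : atlas c := adapted_atlas cc'.
Let ac' : atlas c' := adapted_atlas' cc'.

Lemma extends_at m X S : dom c m ->
  extends iota m (fun m' => push iota m' (X m')) S ->
  S (iota m) = push iota m (X m).
Proof. by move=> cm [_ eS]; exact: (nbhs_singleton eS). Qed.

(** As [lift c c' f] is constant in the imaginary directions, the imaginary part
    of [w] annihilates it. *)
Lemma chart_re_lift m w f : dom c m -> tangent (iota m) w -> smooth_near m f ->
  chart_re c c' m w f = w (lift c c' f).
Proof.
move=> cm tw sf; have c'm := adapted_dom' cc' cm.
rewrite -[in RHS](dirder_coords ac' c'm tw).
rewrite dirderE; last exact: smooth_near_lift.
rewrite /chart_re dirderE //.
have dl := differentiable_lsubmx (n1 := d) (n2 := d) (c' (iota m)).
have lE : lsubmx (c' (iota m)) = c m by rewrite (adapted_iota cc') // row_mxKl.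
rewrite [RHS](@near_eq_derive _ _ _ _
  ((f \o inv c) \o (lsubmx : 'rV[R]_(d + d) -> 'rV[R]_d))).
  rewrite derive_comp //; last by rewrite lE; exact: smooth_near_differentiable.
  by rewrite lE derive_linear //; exact: continuous_lsubmx.
apply: filterS (near_image c'm).
by move=> _ [q cq <-] /=; rewrite /lift /= chart_invK.
Qed.

(** [S] is tangent to M along M, so it only sees the restriction of
    [T (lift c c' f)] to M, which is [Y f]. *)
Lemma extends_lift m X Y S T f : dom c m ->
  smooth_vf_near m X -> smooth_vf_near m Y -> smooth_near m f ->
  extends iota m (fun m' => push iota m' (X m')) S ->
  extends iota m (fun m' => push iota m' (Y m')) T ->
  S (iota m) (fun q => T q (lift c c' f)) = X m (fun m' => Y m' f).
Proof.
move=> cm sX [V [oV Vm] [tY _]] sf eS [[W [oW Wm] [_ sT]] eT].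
have [U [oU Um] sfU] := sf.
have [W' [oW' W'm] sF] := smooth_near_lift cc' cm sf.
rewrite (extends_at cm eS) /push; case: asboolP => [_|[]]; last first.
  have oWW' : open (W `&` W') by exact: openI.
  apply: (smooth_fun_near oWW') => //; apply: sT => //.
  by apply: smooth_fun_sub sF => ? [].
apply: (tangent_local (smooth_vf_near_tangent sX)).
have nUV : nbhs m (U `&` V) by apply: open_nbhs_nbhs; split=> //; exact: openI.
have nUVc : nbhs m ((U `&` V) `&` dom c).
  by apply: filterI => //; exact: near_dom.
apply: filterS2 eT nUVc => m' /= -> [[Um' Vm'] cm'].
by apply: push_lift => //; [exact: tY|exact: smooth_fun_near sfU].
Qed.

(** Both sides are compared on a function f by means of [lift c c' f]: there
    [bracket S T] gives [bracket X Y] on f, by [extends_lift].  In particular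
    [bracket X Y] is a tangent vector because [bracket S T] is one. *)
Lemma bracket_chart_re m X Y S T : dom c m ->
  smooth_vf_near m X -> smooth_vf_near m Y ->
  extends iota m (fun m' => push iota m' (X m')) S ->
  extends iota m (fun m' => push iota m' (Y m')) T ->
  tangent (iota m) (bracket S T (iota m)) ->
  bracket X Y m = chart_re c c' m (bracket S T (iota m)).
Proof.
move=> cm sX sY eS eT tST; apply/funext => f.
have [sf|nsf] := pselect (smooth_near m f); last first.
  by rewrite /chart_re dirder_notsmooth // /bracket; case: asboolP.
rewrite chart_re_lift // /bracket; case: asboolP => // _.
case: asboolP => [_|[]]; last exact: smooth_near_lift.
by rewrite (extends_lift cm sX sY sf eS eT) (extends_lift cm sY sX sf eT eS).
Qed.

End Bracket.

(** * The canonical connection *)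

Section CanonicalConnection.
Context {R : realType} {d : nat} {M : manifold R d} {N : manifold R (d + d)}.
Context (iota : M -> N) (I : endo N) (hN : thickening iota I).
Context (nablaN : connection N) (ln : linear_connection nablaN).
Local Notation nabla := (canonical_connection iota I nablaN).
Local Notation pushes Y := (fun m => push iota m (Y m)).

Lemma thickening_adapted m : exists c c',
  [/\ adapted iota c c', holomorphic_chart I c' & dom c m].
Proof.
have [c [c' [[ac ac' hol] [cm cdom ci _]]]] := thickening_chart hN m.
by exists c, c'.
Qed.

Lemma push_linear m (a : R) (u v : functional M) :
  push iota m (a *: u + v) = a *: push iota m u + push iota m v.
Proof.
apply/funext => f; rewrite -[RHS]/(a * _ + _) /push.
by case: asboolP => // _; rewrite mulr0 addr0.
Qed.

Lemma extends_scale c c' m g Y S : adapted iota c c' -> dom c m ->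
  smooth_near m g -> extends iota m (pushes Y) S ->
  extends iota m (pushes (fun m' => g m' *: Y m'))
    (fun q => lift c c' g q *: S q).
Proof.
move=> cc' cm sg [sS eS]; split.
  by apply: smooth_vf_near_scale => //; exact: smooth_near_lift.
apply: filterS2 eS (near_dom cm) => m' -> cm'.
rewrite (lift_iota cc') //; apply/funext => f; rewrite -[LHS]/(g m' * _) /push.
by case: asboolP => // _; rewrite mulr0.
Qed.

Lemma extends_add m Y Z S T :
  extends iota m (pushes Y) S -> extends iota m (pushes Z) T ->
  extends iota m (pushes (fun m' => Y m' + Z m')) (fun q => S q + T q).
Proof.
move=> [sS eS] [sT eT]; split; first exact: smooth_vf_near_add.
apply: filterS2 eS eT => m' -> ->; apply/funext => f.
rewrite -[LHS]/(_ f + _ f) /push.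
by case: asboolP => // _; rewrite addr0.
Qed.

(** One pair of extensions [S], [T] computes [nabla] at all points near [m], so
    that [nabla] is there the restriction to M of the real part of the smooth
    field of the derivatives of [T] along [S]. *)
Lemma canonical_smooth U X Y : open U -> smooth_vf U X -> smooth_vf U Y ->
  smooth_vf U (fun p => nabla p (X p) Y).
Proof.
move=> oU sX sY; apply: smooth_vf_glue => m Um.
have [c [c' [cc' hol cm]]] := thickening_adapted m.
have sXm : smooth_vf_near m X by exists U.
have sYm : smooth_vf_near m Y by exists U.
have [S [[V [oV Vm] sS] eS]] := extends_push cc' cm sXm.
have [T [[W [oW Wm] sT] eT]] := extends_push cc' cm sYm.
pose D := dom c' `&` (V `&` W).
have oD : open D by apply: openI; [exact: chart_open_dom|exact: openI].
have sZ : smooth_vf D (fun q => nablaN q (S q) T).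
  by apply: (connection_smooth ln) => //;
    [apply: smooth_vf_sub sS|apply: smooth_vf_sub sT] => ? [_ []].
have eST : nbhs m ((fun m' => S (iota m') = push iota m' (X m')) `&`
                   (fun m' => T (iota m') = push iota m' (Y m'))).
  exact: filterI.
move: eST; rewrite nbhsE => -[ O [oO Om] eO].
pose P := (O `&` U) `&` (dom c `&` iota @^-1` D).
have oP : open P by apply: openI; [exact: openI|exact: (open_iota cc')].
exists P; first by do !split => //; exact: (adapted_dom' cc').
apply: (@smooth_vf_ext _ _ _ _
  (fun m' => chart_re c c' m' (nablaN (iota m') (S (iota m')) T))).
  move=> m' [[Om' Um'] [cm' [_ [Vm' Wm']]]].
  have tX : tangent m' (X m') by exact: sX.1.
  have hI := thickening_complex hN.
  rewrite (canonical_connectionE cc' hI hol ln cm' tX (S := T)).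
    by rewrite (eO _ Om').1.
  split; first by exists W.
  by apply: filterS (open_nbhs_nbhs (conj oO Om')) => m'' /eO [].
apply: smooth_vf_dirder => //.
- exact: adapted_atlas cc'.
- by move=> ? [_ []].
move=> j.
apply: (@smooth_fun_sub _ _ _ _ (dom c `&` iota @^-1` D)) => [? []//|].
rewrite (_ : (fun _ => _) =
  (fun q => coords c' (nablaN q (S q) T) 0 (lshift d j)) \o iota).
  apply: (smooth_fun_iota cc') => //.
  by apply: smooth_vf_coord => //; [exact: adapted_atlas' cc'|move=> ? []].
by apply/funext => m'; rewrite mxE.
Qed.

Lemma canonical_linear : linear_connection nabla.
Proof.
have hI := thickening_complex hN.
split.
- move=> m v Y tv sY; have [c [c' [cc' hol cm]]] := thickening_adapted m.
  have [S eS] := extends_push cc' cm sY.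
  rewrite (canonical_connectionE cc' hI hol ln cm tv eS).
  exact: tangent_dirder (adapted_atlas cc') cm.
- move=> m v Y Y' tv sY sY' YY'.
  have [c [c' [cc' hol cm]]] := thickening_adapted m.
  have [S eS] := extends_push cc' cm sY.
  rewrite (canonical_connectionE cc' hI hol ln cm tv eS).
  rewrite (canonical_connectionE cc' hI hol ln cm tv (S := S)) //.
  by case: eS => sS eS; split=> //; apply: filterS2 eS YY' => m' -> ->.
- move=> m a u v Y tu tv sY; have [c [c' [cc' hol cm]]] := thickening_adapted m.
  have [S eS] := extends_push cc' cm sY; have [sS _] := eS.
  have tuv := tangent_linear a tu tv.
  rewrite !(canonical_connectionE cc' hI hol ln cm _ eS) // push_linear.
  rewrite (connection_linear ln) ?(chart_re_linear cc') //;
    exact: (push_tangent cc').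
- move=> m v Y Y' tv sY sY'; have [c [c' [cc' hol cm]]] := thickening_adapted m.
  have [S eS] := extends_push cc' cm sY.
  have [S' eS'] := extends_push cc' cm sY'.
  rewrite (canonical_connectionE cc' hI hol ln cm tv (extends_add eS eS')).
  rewrite (canonical_connectionE cc' hI hol ln cm tv eS).
  rewrite (canonical_connectionE cc' hI hol ln cm tv eS').
  rewrite (connection_additive ln (push_tangent cc' cm tv) eS.1 eS'.1).
  by rewrite -[X in X + _]scale1r (chart_re_linear cc') // scale1r.
- move=> m v g Y tv sg sY; have [c [c' [cc' hol cm]]] := thickening_adapted m.
  have [S eS] := extends_push cc' cm sY.
  rewrite (canonical_connectionE cc' hI hol ln cm tv
    (extends_scale cc' cm sg eS)).
  rewrite (canonical_connectionE cc' hI hol ln cm tv eS).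
  have tp := push_tangent cc' cm tv; have sg' := smooth_near_lift cc' cm sg.
  rewrite (connection_leibniz ln tp sg' eS.1).
  rewrite (push_lift cc' cm tv sg) (lift_iota cc') // (extends_at cm eS).
  rewrite (chart_re_linear cc') //.
  rewrite (chart_re_push cc') //; last exact: smooth_vf_near_tangent.
  by rewrite (chart_re_scale cc').
- exact: canonical_smooth.
Qed.

Lemma canonical_torsion_free : torsion_free nablaN -> torsion_free nabla.
Proof.
move=> tf m X Y sX sY; have hI := thickening_complex hN.
have [c [c' [cc' hol cm]]] := thickening_adapted m.
have [S eS] := extends_push cc' cm sX.
have [T eT] := extends_push cc' cm sY.
have tX := smooth_vf_near_tangent sX; have tY := smooth_vf_near_tangent sY.
have bE := tf _ _ _ eS.1 eT.1.
rewrite (bracket_chart_re cc' cm sX sY eS eT); last first.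
  rewrite -bE -[- _]scaleN1r addrC; apply: tangent_linear.
    apply: (connection_tangent ln); last exact: eS.1.
    exact: smooth_vf_near_tangent eT.1.
  apply: (connection_tangent ln); last exact: eT.1.
  exact: smooth_vf_near_tangent eS.1.
rewrite -bE (canonical_connectionE cc' hI hol ln cm tX eT).
rewrite (canonical_connectionE cc' hI hol ln cm tY eS).
rewrite (extends_at cm eS) (extends_at cm eT).
rewrite [in RHS]addrC -[X in chart_re _ _ _ (X + _)]scaleN1r.
rewrite (chart_re_linear cc') //.
by rewrite scaleN1r addrC.
Qed.

End CanonicalConnection.

Theorem proposition5p12 (R : realType) (n : nat) (M : manifold R (n + n))
    (K : 'rV[R[i]]_2 -> endo M) (hK : integrable_pluricomplex K)
    (N : manifold R ((n + n) + (n + n))) (iota : M -> N) (I : endo N)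
    (hN : thickening iota I)
    (J1 J2 J3 : endo N) (hJ : hypercomplex J1 J2 J3)
    (hJ1 : commuting J1 I) (hJ2 : commuting J2 I) (hJ3 : commuting J3 I)
    (hext : extends_pluricomplex iota I K (hypercomplex_family J1 J2 J3))
    (nablaN : connection N) (hnablaN : obata I J1 J2 J3 nablaN) :
  linear_connection (canonical_connection iota I nablaN) /\
  torsion_free (canonical_connection iota I nablaN).
Proof.
case: hnablaN => ln tf _ _.
by split; [exact: canonical_linear|exact: canonical_torsion_free].
Qed.
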